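(* Let $\Gamma$ be an abelian group, let $R$ be a $\Gamma$-graded gr-prime ring, and let $\mathfrak{a}$ be a nonzero graded (two-sided) ideal of $R$. Suppose that either $[x,y]\in Z(R)$ for all $x,y\in\mathfrak{a}$, or $x\circ y\in Z(R)$ for all $x,y\in\mathfrak{a}$. Then $R$ is a commutative graded ring.
   Context: A ring $R$ is $\Gamma$-graded if $R=\bigoplus_{\tau\in\Gamma}R_\tau$ as additive groups with $R_\tau R_\sigma\subseteq R_{\tau\sigma}$; the set of homogeneous elements is $\mathcal{H}(R)=\bigcup_{\tau}R_\tau$. An ideal $\mathfrak{a}$ is graded if $\mathfrak{a}=\bigoplus_{\tau}(\mathfrak{a}\cap R_\tau)$. $R$ is gr-prime if for $a,b\in\mathcal{H}(R)$, $aRb=0$ implies $a=0$ or $b=0$. $Z(R)$ is the center of $R$, $[x,y]=xy-yx$ and $x\circ y=xy+yx$. *)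

(* Defs.v *)
From HB Require Import structures.
From mathcomp Require Import all_boot all_algebra.

Set Implicit Arguments.
Unset Strict Implicit.
Unset Printing Implicit Defensive.

Import GRing.Theory.

(* Associative rings, not assumed unital or commutative; MathComp's own ring
   structures all carry a unit.  Addition is that of [zmodType] and
   multiplication that of [semigroupType], so products are [(x * y)%g]. *)
HB.mixin Record Semigroup_Zmodule_isRng R
    of Semigroup R & GRing.Zmodule R := {
  rng_mulDl : forall x y z : R, ((x + y)%R * z)%g = ((x * z)%g + (y * z)%g)%R;
  rng_mulDr : forall x y z : R, (x * (y + z)%R)%g = ((x * y)%g + (x * z)%g)%R
}.

#[short(type="rngType")]
HB.structure Definition Rng :=
  {R of Semigroup_Zmodule_isRng R & Semigroup R & GRing.Zmodule R}.

Local Open Scope ring_scope.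

Definition rng_comm (R : rngType) (x y : R) : R := (x * y)%g - (y * x)%g.

Definition rng_anticomm (R : rngType) (x y : R) : R := (x * y)%g + (y * x)%g.

Definition rng_center (R : rngType) (z : R) : Prop :=
  forall r : R, (z * r)%g = (r * z)%g.

Definition additive_subgroup (V : zmodType) (S : V -> Prop) : Prop :=
  S 0 /\ (forall x y, S x -> S y -> S (x - y)).

(* S is the internal direct sum of the family of subgroups (S_t), over a
   possibly infinite index type: every element of S is a finite sum of
   elements of the S_t, and finite sums vanish only trivially. *)
Definition internal_direct_sum (I : eqType) (V : zmodType)
    (S_ : I -> V -> Prop) (S : V -> Prop) : Prop :=
  [/\ forall t, additive_subgroup (S_ t),
      forall t x, S_ t x -> S x,
      forall x, S x -> exists (s : seq I) (f : I -> V),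
        [/\ uniq s, forall t, S_ t (f t) & x = \sum_(t <- s) f t]
    & forall (s : seq I) (f : I -> V), uniq s -> (forall t, S_ t (f t)) ->
        \sum_(t <- s) f t = 0 -> forall t, t \in s -> f t = 0].

(* The grading group is written additively. *)
Definition is_grading (Gamma : zmodType) (R : rngType)
    (R_ : Gamma -> R -> Prop) : Prop :=
  internal_direct_sum R_ (fun _ => True) /\
  (forall t u x y, R_ t x -> R_ u y -> R_ (t + u) (x * y)%g).

Definition homogeneous (Gamma : zmodType) (R : rngType)
    (R_ : Gamma -> R -> Prop) (x : R) : Prop := exists t, R_ t x.

Definition gr_prime (Gamma : zmodType) (R : rngType)
    (R_ : Gamma -> R -> Prop) : Prop :=
  forall a b : R, homogeneous R_ a -> homogeneous R_ b ->
    (forall r : R, (a * r * b)%g = 0) -> a = 0 \/ b = 0.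

Definition two_sided_ideal (R : rngType) (I : R -> Prop) : Prop :=
  additive_subgroup I /\
  (forall r x : R, I x -> I (r * x)%g /\ I (x * r)%g).

Definition graded_ideal (Gamma : zmodType) (R : rngType)
    (R_ : Gamma -> R -> Prop) (I : R -> Prop) : Prop :=
  two_sided_ideal I /\ internal_direct_sum (fun t x => I x /\ R_ t x) I.

(* Main.v *)
Require Import Defs.
From mathcomp Require Import all_boot all_algebra.

Set Implicit Arguments.
Unset Strict Implicit.
Unset Printing Implicit Defensive.

Import GRing.Theory.
Local Open Scope ring_scope.

(** The commutator and the anticommutator are the brackets x y + e y x with
    e = -1 and e = 1.  Write [x, y] for either of them.  Both obey
    [x, x y] = x [x, y] and [x, y r] - [x, y] r = - e y (x r - r x), and the
    argument uses nothing more, so it treats the two hypotheses at once.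

    Let x, y be homogeneous elements of the ideal I.  If all brackets of I are
    central then c = [x, y] and x c = [x, x y] are central, hence
    (x r - r x) c = 0 for every r; as c is central this gives
    (x r - r x) R c = 0.  Because the grading group is abelian, c and, for
    homogeneous r, also x r - r x are homogeneous, so gr-primeness makes one
    of them zero.  If x r - r x were nonzero, then [x, y] = 0 for all
    homogeneous y in I, hence for all y in I because I is graded; the second
    identity gives I (x r - r x) = 0, and a nonzero graded ideal has no nonzero
    homogeneous right annihilator ([ideal_right_annihilator]).  So x r = r x in
    any case: I is central ([ideal_sub_center]).  Then v x y = y v x = v y x
    for v in I and homogeneous x, y in R, so I (x y - y x) = 0, and the same
    annihilator argument gives
    x y = y x ([central_ideal_comm]). *)

Section RngTheory.
Variable R : rngType.
Implicit Types x y z r : R.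

Lemma rng_mul0l x : (0 * x)%g = 0 :> R.
Proof. by apply: (@addrI _ (0 * x)%g); rewrite -rng_mulDl !addr0. Qed.

Lemma rng_mul0r x : (x * 0)%g = 0 :> R.
Proof. by apply: (@addrI _ (x * 0)%g); rewrite -rng_mulDr !addr0. Qed.

Lemma rng_mulNl x y : (- x * y)%g = - (x * y)%g :> R.
Proof. by apply: (@addrI _ (x * y)%g); rewrite -rng_mulDl !subrr rng_mul0l. Qed.

Lemma rng_mulNr x y : (x * - y)%g = - (x * y)%g :> R.
Proof. by apply: (@addrI _ (x * y)%g); rewrite -rng_mulDr !subrr rng_mul0r. Qed.

Lemma rng_comm0P x y : rng_comm x y = 0 <-> (x * y)%g = (y * x)%g.
Proof. by rewrite /rng_comm; split=> [/subr0_eq | ->]; rewrite ?subrr. Qed.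

(** The sign is a boolean so that both values reduce to [rng_comm] and
    [rng_anticomm]: a ring without unit has no element -1 to multiply by. *)
Definition bracket (e : bool) x y : R :=
  (x * y)%g + (if e then - (y * x)%g else (y * x)%g).

Lemma bracket_mul_self e x y : bracket e x (x * y)%g = (x * bracket e x y)%g.
Proof. by rewrite /bracket rng_mulDr; case: e; rewrite ?rng_mulNr !mulgA. Qed.

Lemma bracketDr e x y z : bracket e x (y + z) = bracket e x y + bracket e x z.
Proof.
rewrite /bracket rng_mulDr rng_mulDl addrACA.
by case: e; rewrite // opprD.
Qed.

Lemma bracket0r e x : bracket e x 0 = 0.
Proof.
by rewrite /bracket rng_mul0r rng_mul0l; case: e; rewrite ?oppr0 addr0.
Qed.

(** This identity turns the vanishing of all brackets with [x] into
    annihilation of the commutators of [x]. *)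
Lemma bracket_mulr_eq0 e x y r :
  bracket e x y = 0 -> bracket e x (y * r)%g = 0 -> (y * rng_comm x r)%g = 0.
Proof.
rewrite /bracket /rng_comm rng_mulDr rng_mulNr !mulgA => xy0.
have -> : (x * y)%g = (if e then (y * x)%g else - (y * x)%g).
  by move: xy0; case: e => [/subr0_eq // | /addr0_eq <-]; rewrite opprK.
by case: e {xy0} => [//|]; rewrite rng_mulNl addrC => /subr0_eq ->; rewrite subrr.
Qed.

Lemma central_bracket_mul e x y r :
  rng_center (bracket e x y) -> rng_center (bracket e x (x * y)%g) ->
  (rng_comm x r * bracket e x y)%g = 0.
Proof.
rewrite bracket_mul_self; set c := bracket e x y => cZ xcZ.
by rewrite /rng_comm rng_mulDl rng_mulNl -!mulgA -cZ (mulgA x) xcZ subrr.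
Qed.

End RngTheory.

Lemma direct_sum_ind (I : eqType) (V : zmodType) (S_ : I -> V -> Prop)
    (S P : V -> Prop) :
  internal_direct_sum S_ S -> P 0 -> (forall x y, P x -> P y -> P (x + y)) ->
  (forall t x, S_ t x -> P x) -> forall x, S x -> P x.
Proof.
move=> [_ _ dec _] P0 PD PS x /dec[s [f [_ Sf ->]]].
by apply: big_ind => // t _; apply: PS (Sf t).
Qed.

Lemma direct_sum_neq0 (I : eqType) (V : zmodType) (S_ : I -> V -> Prop)
    (S : V -> Prop) (x : V) :
  internal_direct_sum S_ S -> S x -> x <> 0 -> exists t y, S_ t y /\ y <> 0.
Proof.
move=> [_ _ dec _] /dec[s [f [_ Sf ->]]] nz.
have [/hasP[t _ /eqP ft0] | /hasPn f0] := boolP (has (fun t => f t != 0) s).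
  by exists t, (f t).
by case: nz; apply: big1_seq => t /andP[_ /f0/negPn/eqP].
Qed.

Section GrPrime.
Variables (Gamma : zmodType) (R : rngType) (R_ : Gamma -> R -> Prop).
Hypotheses (hR : is_grading R_) (hprime : gr_prime R_).

Lemma homogeneous_bracket e x y :
  homogeneous R_ x -> homogeneous R_ y -> homogeneous R_ (bracket e x y).
Proof.
case: hR => -[sub _ _ _] mulR [t xt] [u yu]; exists (t + u).
have [z0 subR] := sub (t + u).
have xy := mulR _ _ _ _ xt yu.
have yx : R_ (t + u) (y * x)%g by rewrite addrC; apply: mulR.
have Nyx : R_ (t + u) (- (y * x)%g) by rewrite -sub0r; apply: subR.
rewrite /bracket; case: e; first exact: subR.
by rewrite -[(y * x)%g]opprK; apply: subR.
Qed.

Lemma homogeneous_comm x y :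
  homogeneous R_ x -> homogeneous R_ y -> homogeneous R_ (rng_comm x y).
Proof. exact: (homogeneous_bracket true). Qed.

Lemma homogeneous_ind (P : R -> Prop) :
  P 0 -> (forall x y, P x -> P y -> P (x + y)) ->
  (forall x, homogeneous R_ x -> P x) -> forall x, P x.
Proof.
move=> P0 PD Ph x; apply: (direct_sum_ind (proj1 hR) P0 PD) (I : True) => t y yt.
by apply: Ph; exists t.
Qed.

Lemma center_homogeneous x :
  (forall r, homogeneous R_ r -> (x * r)%g = (r * x)%g) -> rng_center x.
Proof.
move=> xr; apply: homogeneous_ind => [|y z xy xz|//].
- by rewrite rng_mul0l rng_mul0r.
- by rewrite rng_mulDl rng_mulDr xy xz.
Qed.

Section Ideal.
Variable a : R -> Prop.
Hypotheses (ha : graded_ideal R_ a) (ha0 : exists x : R, a x /\ x <> 0).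

(** For a nonzero homogeneous [c] in the ideal, the products [c r] also lie in
    the ideal, so [b] satisfies [c r b = 0] for all [r] and gr-primeness
    applies. *)
Lemma ideal_right_annihilator b :
  homogeneous R_ b -> (forall v, a v -> (v * b)%g = 0) -> b = 0.
Proof.
move=> bh ab0; have [[[_ aM] dec] [x [ax x0]]] := (ha, ha0).
have [t [c [[ac ct] c0]]] := direct_sum_neq0 dec ax x0.
have [|//|] := hprime (ex_intro _ t ct) bh; last by [].
by move=> r; apply: ab0; case: (aM r c ac).
Qed.

(** For fixed homogeneous [x] and [r], gr-primeness leaves either
    [rng_comm x r = 0] or every bracket of [x] with the ideal zero; the second
    alternative again forces [rng_comm x r = 0]. *)
Lemma ideal_sub_center e :
  (forall x y, a x -> a y -> rng_center (bracket e x y)) ->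
  forall x, a x -> rng_center x.
Proof.
move=> aZ; have [[[_ aM] dec] _] := (ha, ha0).
apply: (direct_sum_ind dec) => [r|x y xZ yZ r|t x [ax xt]].
- by rewrite rng_mul0l rng_mul0r.
- by rewrite rng_mulDl rng_mulDr xZ yZ.
have xh : homogeneous R_ x by exists t.
apply: center_homogeneous => r rh; apply/rng_comm0P.
have [//|/eqP nz] := eqVneq (rng_comm x r) 0.
have x_a0 y : a y -> bracket e x y = 0.
  move: y; apply: (direct_sum_ind dec) => [|y z y0 z0|u y [ay yu]].
  - exact: bracket0r.
  - by rewrite bracketDr y0 z0 addr0.
  have yh : homogeneous R_ y by exists u.
  have [s|//|//] := hprime (homogeneous_comm xh rh) (homogeneous_bracket e xh yh).
  have xyZ := aZ _ _ ax ay.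
  have xxyZ := aZ _ _ ax (proj1 (aM x y ay)).
  by rewrite -mulgA -xyZ mulgA (central_bracket_mul _ xyZ xxyZ) rng_mul0l.
apply: ideal_right_annihilator; first exact: homogeneous_comm.
move=> v av; apply: (@bracket_mulr_eq0 _ e); apply: x_a0 => //.
exact: (proj2 (aM r v av)).
Qed.

Lemma central_ideal_comm :
  (forall x, a x -> rng_center x) -> forall x y : R, (x * y)%g = (y * x)%g.
Proof.
move=> aZ; have [[[_ aM] _] _] := (ha, ha0).
apply: homogeneous_ind => [y|x z xZ zZ y|x xh].
- by rewrite rng_mul0l rng_mul0r.
- by rewrite rng_mulDl rng_mulDr xZ zZ.
apply: center_homogeneous => y yh; apply/rng_comm0P.
apply: ideal_right_annihilator; first exact: homogeneous_comm.
move=> v av; rewrite /rng_comm rng_mulDr rng_mulNr !mulgA.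
by rewrite (aZ _ (proj2 (aM x v av))) mulgA -(aZ v av) subrr.
Qed.

End Ideal.
End GrPrime.

Theorem proposition4p3 (Gamma : zmodType) (R : rngType)
    (R_ : Gamma -> R -> Prop) (a : R -> Prop)
    (hR : is_grading R_) (hprime : gr_prime R_)
    (ha : graded_ideal R_ a) (ha0 : exists x : R, a x /\ x <> 0%R)
    (hcomm :
      (forall x y : R, a x -> a y -> rng_center (rng_comm x y)) \/
      (forall x y : R, a x -> a y -> rng_center (rng_anticomm x y))) :
  forall x y : R, (x * y)%g = (y * x)%g.
Proof.
apply: (central_ideal_comm hR hprime ha ha0).
case: hcomm => aZ.
- exact: (ideal_sub_center hR hprime ha ha0 (e := true)).
- exact: (ideal_sub_center hR hprime ha ha0 (e := false)).
Qed.
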